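(* For every integer $n\ge1$, $$\sum_{\nu\in\mathcal{Q}_n}q^{\mathrm{Inv}(\nu)}=C_{n+1}(q).$$
   Context: A Dyck path of length $m$ is a word in $\{0,1\}$ with $m$ letters $0$ and $m$ letters $1$ in which every prefix contains at least as many $0$'s as $1$'s; it is prime if it is non-empty and returns to balance (equal numbers of $0$'s and $1$'s in a non-empty prefix) only at its end. A Dyck path $\mu=\mu_1\cdots\mu_{2m}$ is symmetric if $\mu=\overline{\mu_{2m}}\cdots\overline{\mu_1}$ with $\overline0=1$, $\overline1=0$. A symmetric Dyck path is identified with its first half $\nu=\mu_1\cdots\mu_m$. For $1\le i\le m$ with $\mu_i=0$ let $j>i$ be minimal such that $\mu_i\cdots\mu_j$ is a prime Dyck path; the pair $(i,j)$ is an arch if $j\le m$, and $i$ is a half-arch if $j\ge m+1$. The size of a symmetric Dyck path is the number of its arches plus the number of its half-arches, and $\mathcal{Q}_n$ is the set of symmetric Dyck paths of size $n$ (so $m$ varies). Let $\nu=\nu_1\cdots\nu_m\in\mathcal{Q}_n$ have arches $a_1,\ldots,a_{n-k}$ and half-arches $b_1,\ldots,b_k$. Then $$\mathrm{Inv}_1(\nu):=k+\sum_{j=1}^k\#\{a_i: a_i\text{ is to the right of }b_j\text{ in }\nu\}+\sum_{j=1}^k\#\{b_i:b_i\text{ is to the right of }b_j\text{ in }\nu\},$$ $$\mathrm{Inv}_2(\nu):=\#\{(i,j):1\le i<j\le m,\ (\nu_i,\nu_j)=(1,0)\},\qquad \mathrm{Inv}(\nu):=\mathrm{Inv}_1(\nu)+\mathrm{Inv}_2(\nu).$$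 The $q$-Catalan numbers $C_n=C_n(q)$, $n\ge0$, are the polynomials defined by $z=\sum_{n=1}^{\infty}C_{n-1}(q)z^n(1-z)(1-qz)\cdots(1-q^{n-1}z)$. *)

(* Defs.v *)
From HB Require Import structures.
From mathcomp Require Import all_boot all_order all_algebra zify.
Set Implicit Arguments.
Unset Strict Implicit.
Unset Printing Implicit Defensive.
Import GRing.Theory.

(* Letters: [false] is 0 and [true] is 1.  Positions are numbered from 0, so
   a condition j <= m on positions 1..2m reads j < m here. *)
Definition word := seq bool.
Definition zeros (w : word) := count_mem false w.
Definition ones (w : word) := count_mem true w.

Definition dyck (w : word) : bool :=
  (zeros w == ones w) &&
  [forall k : 'I_(size w).+1, ones (take k w) <= zeros (take k w)].

Definition prime_dyck (w : word) : bool :=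
  [&& dyck w, w != [::] &
      [forall k : 'I_(size w).+1,
         [&& 0 < k & zeros (take k w) == ones (take k w)] ==> (k == size w :> nat)]].

Definition sym_dyck (mu : word) : bool := dyck mu && (mu == rev (map negb mu)).

(* A symmetric Dyck path is kept as the full word mu; its first half nu is the
   part of mu at the positions i < half_len mu. *)
Definition half_len (mu : word) : nat := (size mu)./2.

Definition factor (mu : word) (i j : nat) : word := drop i (take j.+1 mu).

(* The least j > i such that the factor from i to j (both included) is a prime
   Dyck path; the default value [size mu] is not reached when mu is Dyck and
   has letter 0 at i (lemma [partner_lt]). *)
Definition partner (mu : word) (i : nat) : nat :=
  find (fun j => (i < j) && prime_dyck (factor mu i j)) (iota 0 (size mu)).

Definition arches (mu : word) : seq (nat * nat) :=
  [seq (i, partner mu i) | i <- iota 0 (half_len mu) &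
     (nth true mu i == false) && (partner mu i < half_len mu)].

Definition half_arches (mu : word) : seq nat :=
  [seq i <- iota 0 (half_len mu) |
     (nth true mu i == false) && (half_len mu <= partner mu i)].

Definition path_size (mu : word) : nat :=
  size (arches mu) + size (half_arches mu).

Definition Inv1 (mu : word) : nat :=
  size (half_arches mu)
  + \sum_(b <- half_arches mu) count (fun a : nat * nat => b < a.1) (arches mu)
  + \sum_(b <- half_arches mu) count (fun b' => b < b') (half_arches mu).

Definition Inv2 (mu : word) : nat :=
  #|[set p : 'I_(half_len mu) * 'I_(half_len mu) |
      [&& p.1 < p.2, nth true mu p.1 == true & nth true mu p.2 == false]]|.

Definition Inv (mu : word) : nat := Inv1 mu + Inv2 mu.

(* The symmetric Dyck paths of size n, listed without repetition; the length
   bound excludes none of them, see [mem_symdyck_paths]. *)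
Definition symdyck_paths (n : nat) : seq word :=
  [seq mu <- flatten [seq [seq tval t | t <- enum {: l.-tuple bool}]
                         | l <- iota 0 (4 * n).+1]
     | sym_dyck mu && (path_size mu == n)].

Local Open Scope ring_scope.

(* z = \sum_(n >= 1) C_(n-1)(q) z^n (1 - z)(1 - q z)...(1 - q^(n-1) z) in
   Z[q][[z]]: each coefficient of the partial sums is eventually that of z.
   The inner indeterminate of {poly {poly int}} is q, the outer one is z. *)
Definition is_qCatalan (C : nat -> {poly int}) : Prop :=
  forall d : nat, exists N0 : nat, forall N : nat, (N0 <= N)%N ->
    (\sum_(1 <= n < N.+1)
        (C n.-1)%:P * 'X^n * \prod_(i < n) (1 - ('X^i)%:P * 'X))`_d
    = ('X : {poly {poly int}})`_d.

Local Close Scope ring_scope.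

Lemma zeros_ones (w : word) : zeros w + ones w = size w.
Proof. by rewrite /zeros /ones; elim: w => // -[] w /=; lia. Qed.

Lemma path_sizeE mu : path_size mu = zeros (take (half_len mu) mu).
Proof.
rewrite /path_size /arches /half_arches size_map !size_filter /zeros.
have hm : half_len mu <= size mu by rewrite /half_len; lia.
have -> : take (half_len mu) mu = [seq nth true mu i | i <- iota 0 (half_len mu)].
  apply: (@eq_from_nth _ true) => [|i]; rewrite size_take_min; first by
    rewrite size_map size_iota; lia.
  move=> hi; have hi' : i < half_len mu by lia.
  by rewrite nth_take // (nth_map 0) ?size_iota // nth_iota.
rewrite count_map; elim: (iota _ _) => //= i s <-.
by case: (nth true mu i == false) => //=; case: ltnP => /= _; lia.
Qed.

Lemma dyck_take w k : dyck w -> ones (take k w) <= zeros (take k w).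
Proof.
case/andP=> /eqP e /forallP h; case: (leqP k (size w)) => hk.
  by have := h (Ordinal (hk : k < (size w).+1)).
by rewrite take_oversize ?e // ltnW.
Qed.

Lemma mem_symdyck_paths n mu :
  (mu \in symdyck_paths n) = sym_dyck mu && (path_size mu == n).
Proof.
rewrite mem_filter; case: (boolP (sym_dyck mu && _)) => // /andP[/andP[D _] /eqP h].
rewrite andTb; have H := dyck_take (half_len mu) D.
have H2 := zeros_ones (take (half_len mu) mu).
move: h H H2; rewrite path_sizeE => h; rewrite h size_take_min => H H2.
have Z := zeros_ones mu; have /andP[/eqP E _] := D.
have {H H2 Z E} : size mu <= 4 * n.
  move: Z H H2; rewrite E /half_len.
  set o' := ones (take _ _); move: o' => o'.
  move: (size mu) (ones mu) => s o Z H H2; lia.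
move=> le4n.
apply/flattenP; exists [seq tval t | t <- enum {: (size mu).-tuple bool}].
  by apply/mapP; exists (size mu); rewrite // mem_iota.
by apply/mapP; exists (in_tuple mu); rewrite ?mem_enum.
Qed.

Lemma symdyck_paths_uniq n : uniq (symdyck_paths n).
Proof.
apply: filter_uniq; move: (iota_uniq 0 (4 * n).+1).
elim: (iota _ _) => //= l s IH /andP[hl hs].
rewrite cat_uniq IH // andbT map_inj_uniq ?enum_uniq //=; last exact: val_inj.
apply/hasPn=> w /flattenP[_ /mapP[l' hl' ->] /mapP[t _ ->]].
apply/negP=> /mapP[t' _ e]; move: hl.
by have := size_tuple t; rewrite e size_tuple => ->; rewrite hl'.
Qed.

Lemma partner_lt mu i : dyck mu -> i < size mu -> nth true mu i = false ->
  i < partner mu i < size mu.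
Proof.
move=> D hi h0.
pose P j := (i < j < size mu) &&
  (ones (drop i (take j.+1 mu)) >= zeros (drop i (take j.+1 mu))).
have cutE j : i <= j -> take j mu = take i mu ++ drop i (take j mu).
  by move=> ij; rewrite -{1}(cat_take_drop i (take j mu)) take_takel.
have exP : exists j, P j.
  exists (size mu).-1; rewrite /P prednK; last lia.
  rewrite take_size.
  have H := dyck_take i D; have /andP[/eqP E _] := D.
  have E1 : zeros (take i mu) + zeros (drop i mu) = ones (take i mu) + ones (drop i mu).
    by rewrite /zeros /ones -!count_cat cat_take_drop.
  have E2 : ones (drop i mu) >= zeros (drop i mu) by lia.
  rewrite E2 andbT; apply/andP; split; last lia.
  case: (ltnP i (size mu).-1) => // hi'.
  move: E2; rewrite (drop_nth true) // h0 drop_oversize //; lia.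
case: (ex_minnP exP) => j /andP[/andP[ij jm] le_oz] minj.
have szf : size (factor mu i j) = j.+1 - i.
  by rewrite /factor size_drop size_take_min; lia.
have tkf k : i + k <= j.+1 -> take k (factor mu i j) = drop i (take (i + k) mu).
  by move=> hk; rewrite /factor take_drop addnC take_takel //; lia.
have small k : 0 < k -> k < j.+1 - i ->
    ones (take k (factor mu i j)) < zeros (take k (factor mu i j)).
  move=> k0 kj; rewrite tkf; last lia.
  case: (leqP k 1) => k1.
    have -> : k = 1 by lia.
    by rewrite addn1 (take_nth true) // h0 -cats1 drop_cat size_take_min
      (_ : minn i (size mu) = i) ?ltnn ?subnn ?drop0 //; lia.
  case: ltnP => // hle; have := minj (i + k).-1; rewrite /P prednK; last lia.
  by rewrite hle andbT => H; have := H _; lia.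
have bal : zeros (factor mu i j) = ones (factor mu i j).
  have := small (j - i); rewrite tkf; last lia.
  rewrite subnKC; last lia. move=> H.
  move: le_oz; rewrite -/(factor mu i j).
  have -> : factor mu i j = drop i (take j mu) ++ [:: nth true mu j].
    rewrite /factor (take_nth true) // -cats1 drop_cat size_take_min.
    by case: ltnP => //; lia.
  rewrite /zeros /ones !count_cat /= => H'.
  have {}H := H ltac:(lia) ltac:(lia).
  move: H H'; rewrite /zeros /ones; case: (nth true mu j) => /=; lia.
have prj : prime_dyck (factor mu i j).
  apply/and3P; split.
  - apply/andP; split; first by rewrite bal.
    apply/forallP=> -[k hk] /=; rewrite szf in hk.
    case: (posnP k) => [->|k0]; first by rewrite take0.
    case: (ltnP k (j.+1 - i)) => hk'; first exact/ltnW/small.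
    by rewrite take_oversize ?szf // bal.
  - by rewrite -size_eq0 szf; lia.
  - apply/forallP=> -[k hk] /=; rewrite szf in hk *; apply/implyP=> /andP[k0 /eqP e].
    by case: (ltnP k (j.+1 - i)) => hk'; [have := small k k0 hk'; lia | lia].
have hs : has (fun j => (i < j) && prime_dyck (factor mu i j)) (iota 0 (size mu)).
  by apply/hasP; exists j; rewrite ?mem_iota //= ij.
have := hs; rewrite has_find size_iota -/(partner mu i) => lt; rewrite lt andbT.
by have := nth_find 0 hs; rewrite -/(partner mu i) nth_iota // => /andP[].
Qed.

Local Open Scope ring_scope.

Section QCatalanExists.

Let T (n : nat) : {poly {poly int}} := 'X^n * \prod_(i < n) (1 - ('X^i)%:P * 'X).

Let T_small n d : (d < n)%N -> (T n)`_d = 0.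
Proof. by move=> h; rewrite coefXnM h. Qed.

Let T_diag n : (T n)`_n = 1.
Proof.
rewrite coefXnM ltnn subnn -horner_coef0 horner_prod big1 // => i _.
by rewrite !hornerE subr0.
Qed.

Let is_qCatalanP C : is_qCatalan C <->
  forall d, \sum_(1 <= n < d.+1) C n.-1 * (T n)`_d = ('X : {poly {poly int}})`_d.
Proof.
have key N d : (d <= N)%N ->
    (\sum_(1 <= n < N.+1)
        (C n.-1)%:P * 'X^n * \prod_(i < n) (1 - ('X^i)%:P * 'X))`_d
    = \sum_(1 <= n < d.+1) C n.-1 * (T n)`_d.
  move=> dN; rewrite coef_sum (big_cat_nat (n := d.+1)) //=.
  rewrite [X in _ + X = _]big1_seq ?addr0 => [|n /=].
    by apply: eq_bigr => n _; rewrite -mulrA coefCM.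
  rewrite mem_index_iota => /andP[hn _].
  by rewrite -mulrA coefCM -/(T n) T_small ?mulr0.
split=> h d.
  have [N0 hN] := h d; rewrite -(key (maxn N0 d)) ?leq_maxr //.
  by apply: hN; rewrite leq_maxl.
by exists d => N dN; rewrite key.
Qed.

Let cs_step (s : seq {poly int}) : seq {poly int} :=
  let d := (size s).+1 in
  rcons s (('X : {poly {poly int}})`_d - \sum_(1 <= n < d) s`_n.-1 * (T n)`_d).

Lemma is_qCatalan_exists : exists C, is_qCatalan C.
Proof.
pose s k := iter k cs_step [::].
have ss k : size (s k) = k by elim: k => //= k IH; rewrite size_rcons IH.
have sn k n : (n < k)%N -> (s k)`_n = (s n.+1)`_n.
  elim: k => // k IH; rewrite ltnS leq_eqVlt => /orP[/eqP->//|h].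
  by rewrite -IH // /s /= nth_rcons ss h.
have sE d : (s d.+1)`_d =
    ('X : {poly {poly int}})`_d.+1 - \sum_(1 <= n < d.+1) (s d)`_n.-1 * (T n)`_d.+1.
  by rewrite [s d.+1]/(cs_step (s d)) /cs_step nth_rcons ss ltnn eqxx.
exists (fun n => (s n.+1)`_n); apply/is_qCatalanP => -[|d].
  by rewrite big_geq // coefX.
rewrite big_nat_recr // T_diag mulr1 succnK sE.
rewrite (eq_big_nat _ _ (F2 := fun n => (s d)`_n.-1 * (T n)`_d.+1)) => [|[|n] // /andP[_ h]].
  by rewrite /= addrCA subrr addr0.
by rewrite succnK (sn d n).
Qed.

Lemma is_qCatalan_unique C C' : is_qCatalan C -> is_qCatalan C' -> C =1 C'.
Proof.
move=> /is_qCatalanP h /is_qCatalanP h' n.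
have [k] := ubnP n; elim: k n => // k IH n nk.
have := etrans (h n.+1) (esym (h' n.+1)).
rewrite big_nat_recr // [X in _ = X -> _]big_nat_recr // T_diag !mulr1 !succnK.
rewrite (eq_big_nat _ _ (F2 := fun i => C' i.-1 * (T i)`_n.+1)) => [/addrI //|].
by move=> [|i] // /andP[_ hi]; rewrite succnK IH //; lia.
Qed.

End QCatalanExists.

(* Main.v *)
Require Import Defs.
From mathcomp Require Import all_boot all_order all_algebra zify ring.
Import GRing.Theory.

(** A symmetric Dyck path is its first half w, an arbitrary word all of whose
    prefixes have at least as many 0s as 1s.  Read w from right to left and
    match each 0 with the nearest 1 to its right that is still free.  A 0 that
    finds a partner opens an arch; a 0 that finds none is a half-arch.  So the
    first half of a path is exactly a word that has no free 1 left at the end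
    ([sym_dyck_unfold]), and arches and half-arches can be told apart by the
    number [unmatched] of free 1s of the suffix ([partner_unfold]).

    The three terms of Inv1 say that each half-arch b contributes 1 plus the
    number of 0s to its right.  Equivalently, after inserting a letter 1 just
    before every half-arch, Inv is the plain number of pairs (1, 0) in order.
    Putting a 0 in front and a 1 at the end of this enlarged word gives a Dyck
    path of semilength n + 1 with the same number of such pairs, and this is a
    bijection onto these paths, the half-arches marking the returns to balance.

    Both sides of the bijection are generated letter by letter from the right,
    so it is enough to compare recurrences.  The suffixes of Dyck paths
    with n letters 0 and n + e letters 1 have the generating polynomial
    [qballot n e] for the number of pairs (1, 0): a new leading 1 makes n new
    pairs, a new leading 0 makes none.  The half-words with n
    letters 0 and p free letters 1 have generating polynomial
    [qballot n p.+1] ([sum_weight_half_words]), so that the sum over the paths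
    of size n is [qballot n 1 = qballot n.+1 0].

    It remains to see that [qballot n 0] satisfies the equation of the
    q-Catalan numbers.  With H_n(z) the sum of [qballot n e] z^e over e, the
    recurrence reads
      H_n = qballot n 0 + z (1 - q^(n+1) z) H_(n+1)  and  (1 - z) H_0 = 1.
    Substituting it repeatedly into 1 = (1 - z) H_0 gives
      1 = sum_(i < n) (qballot i 0) z^i (1 - z) ... (1 - q^i z)
          + z^n (1 - z) ... (1 - q^n z) H_n,
    whose last term vanishes z-adically; multiply by z to conclude. *)

(** * Half-words and their weight *)

(** Number of free letters 1 after matching each 0, from right to left, with
    the nearest free 1 on its right. *)
Fixpoint unmatched (w : word) : nat :=
  if w is x :: w' then if x then (unmatched w').+1 else (unmatched w').-1
  else 0.

(** The contribution to Inv of a letter x followed by w.  A 1 contributes the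
    pairs (1, 0) that it starts.  The test on [unmatched] recognises a half-arch;
    it contributes its unit of k and one unit for each arch or half-arch to its
    right, that is, for each 0 there. *)
Definition letter_weight (x : bool) (w : word) : nat :=
  if x then zeros w else if unmatched w == 0 then (zeros w).+1 else 0.

(** Equal to Inv of the path with first half w, but defined for all words so
    that it can be computed one letter at a time. *)
Fixpoint weight (w : word) : nat :=
  if w is x :: w' then letter_weight x w' + weight w' else 0.

Definition unfold_half (w : word) : word := w ++ rev (map negb w).

(** The words with n letters 0 and p free letters 1, listed by first letter.  A
    leading 0 takes one of p.+1 free 1s of the rest; for p = 0 it can also be a
    half-arch, with no free 1 after it. *)
Fixpoint half_words (n : nat) : nat -> seq word :=
  if n is n'.+1 then
    fix half_words_n p :=
      if p is p'.+1 then
        map (cons true) (half_words_n p') ++ map (cons false) (half_words n' p'.+2)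
      else map (cons false) (half_words n' 1 ++ half_words n' 0)
  else fun p => [:: nseq p true].

Lemma half_wordsS0 n :
  half_words n.+1 0 = map (cons false) (half_words n 1 ++ half_words n 0).
Proof. by []. Qed.

Lemma half_wordsSS n p : half_words n.+1 p.+1 =
  map (cons true) (half_words n.+1 p) ++ map (cons false) (half_words n p.+2).
Proof. by []. Qed.

Arguments half_words : simpl never.

Lemma mem_map_cons (x y : bool) (w : word) (s : seq word) :
  (x :: w \in map (cons y) s) = (x == y) && (w \in s).
Proof. by elim: s => [|v s IH]; rewrite ?andbF //= !inE IH eqseq_cons -andb_orr. Qed.

Lemma nil_map_cons (y : bool) (s : seq word) : ([::] \in map (cons y) s) = false.
Proof. by elim: s. Qed.

Lemma no_zeros (w : word) : zeros w = 0 -> w = nseq (unmatched w) true.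
Proof. by elim: w => // -[] //= w IH H; rewrite -IH. Qed.

Lemma unmatched_nseq p : unmatched (nseq p true) = p.
Proof. by elim: p => //= p ->. Qed.

Lemma mem_half_words n p w :
  (w \in half_words n p) = (zeros w == n) && (unmatched w == p).
Proof.
elim: n p w => [|n IHn].
  move=> p w; rewrite inE; apply/eqP/andP=> [->|[/eqP z /eqP <-]]; last exact: no_zeros.
  by rewrite unmatched_nseq /zeros count_nseq.
elim=> [|p IHp] [|[] w]; rewrite ?half_wordsS0 ?half_wordsSS;
  rewrite ?mem_cat ?nil_map_cons ?mem_map_cons ?mem_cat ?IHn ?IHp //=.
all: rewrite /zeros /= ?add0n ?orbF ?andbF ?eqSS //.
- by case: (unmatched w) => [|[|?]] //=; rewrite ?andbF ?andbT ?orbF.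
- by case: (unmatched w) => [|?] //=; rewrite ?andbF.
Qed.

Lemma half_words_uniq n p : uniq (half_words n p).
Proof.
have cI x : injective (@cons bool x) by move=> ? ? [].
elim: n p => [|n IHn] //; elim=> [|p IHp].
  rewrite half_wordsS0 map_inj_uniq // cat_uniq !IHn andbT /=; apply/hasPn => w.
  by rewrite !mem_half_words => /andP[_ /eqP->]; rewrite andbF.
rewrite half_wordsSS cat_uniq !map_inj_uniq // IHn IHp andbT.
by apply/hasPn => w /mapP[v _ ->]; rewrite mem_map_cons.
Qed.

(** The number of free 1s is the largest excess of 1s over 0s in a prefix. *)
Lemma unmatched_leP c w :
  (forall k, ones (take k w) <= zeros (take k w) + c) <-> unmatched w <= c.
Proof.
elim: w c => [|[] w IH] c /=; split=> // H.
- case: c H => [|c] H; first by have := H 1; rewrite /= take0.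
  by rewrite ltnS; apply/IH => k; have := H k.+1; rewrite /ones /zeros /=; lia.
- case: c H => [|c] //; rewrite ltnS => /IH H [|k] //=.
  by have := H k; rewrite /ones /zeros /=; lia.
- suff /IH : forall k, ones (take k w) <= zeros (take k w) + c.+1 by lia.
  by move=> k; have := H k.+1; rewrite /ones /zeros /=; lia.
- have /IH H' : unmatched w <= c.+1 by lia.
  by case=> [|k] //; have := H' k; rewrite /ones /zeros /=; lia.
Qed.

Lemma unmatched0P w :
  reflect (forall k, ones (take k w) <= zeros (take k w)) (unmatched w == 0).
Proof.
rewrite -leqn0; apply: (iffP idP) => [/unmatched_leP H k|H].
  by have := H k; rewrite addn0.
by apply/unmatched_leP => k; rewrite addn0.
Qed.

(** * Symmetric Dyck paths as half-words *)

Lemma zeros_mirror w : zeros (rev (map negb w)) = ones w.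
Proof. by rewrite /zeros /ones count_rev count_map; apply: eq_count; case. Qed.

Lemma ones_mirror w : ones (rev (map negb w)) = zeros w.
Proof. by rewrite /zeros /ones count_rev count_map; apply: eq_count; case. Qed.

Lemma size_mirror w : size (rev (map negb w)) = size w.
Proof. by rewrite size_rev size_map. Qed.

Lemma mirrorK : involutive (fun w => rev (map negb w)).
Proof. by move=> w; rewrite map_rev revK -map_comp map_id_in // => x _ /=; rewrite negbK. Qed.

Lemma half_len_unfold w : half_len (unfold_half w) = size w.
Proof. by rewrite /half_len /unfold_half size_cat size_mirror; lia. Qed.

Lemma take_unfold w k : k <= size w -> take k (unfold_half w) = take k w.
Proof. by move=> h; rewrite takel_cat. Qed.

Lemma nth_unfold w i : i < size w -> nth true (unfold_half w) i = nth true w i.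
Proof. by move=> h; rewrite nth_cat h. Qed.

(** Prefixes beyond the middle need no condition of their own: by symmetry the
    suffix after such a prefix mirrors a short prefix, so it has at least as many
    1s as 0s, while the whole word is balanced. *)
Lemma sym_dyck_unfold w : sym_dyck (unfold_half w) = (unmatched w == 0).
Proof.
apply/idP/idP => [/andP[D _]|U].
  apply/unmatched0P => k; wlog h : k / k <= size w.
    move=> H; case: (leqP k (size w)) => h; first exact: H.
    by have := H _ (leqnn (size w)); rewrite take_size take_oversize // ltnW.
  by have := dyck_take k D; rewrite take_unfold.
have M : unfold_half w = rev (map negb (unfold_half w)).
  by rewrite map_cat rev_cat mirrorK.
rewrite /sym_dyck -M eqxx andbT.
have E : zeros (unfold_half w) = ones (unfold_half w).
  by rewrite [in RHS]M ones_mirror.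
rewrite /dyck E eqxx; apply/forallP => -[k hk] /=.
move/unmatched0P: U => U.
case: (leqP k (size w)) => h; first by rewrite take_unfold.
(* The prefix that mirrors the suffix starting at k. *)
have := U (size (unfold_half w) - k).
rewrite -(take_unfold w); last by rewrite size_cat size_mirror; lia.
rewrite -ones_mirror -[X in X <= _]zeros_mirror map_take rev_take size_map -M.
have -> : drop (size (unfold_half w) - (size (unfold_half w) - k)) (unfold_half w)
        = drop k (unfold_half w) by congr drop; lia.
move: E; rewrite -[in zeros (unfold_half w)](cat_take_drop k (unfold_half w)).
rewrite -[in ones (unfold_half w)](cat_take_drop k (unfold_half w)).
by rewrite /zeros /ones !count_cat; lia.
Qed.

Lemma sym_dyckE mu : sym_dyck mu -> mu = unfold_half (take (half_len mu) mu).
Proof.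
case/andP => /andP[/eqP E _] /eqP M.
have S : size mu = half_len mu + half_len mu.
  by have := zeros_ones mu; rewrite /half_len E; lia.
rewrite /unfold_half map_take rev_take size_map -M -[LHS](cat_take_drop (half_len mu)).
by congr (_ ++ drop _ _); lia.
Qed.

Lemma symdyck_paths_half_words n :
  perm_eq (symdyck_paths n) (map unfold_half (half_words n 0)).
Proof.
have szE w : take (half_len (unfold_half w)) (unfold_half w) = w.
  by rewrite half_len_unfold take_unfold // take_size.
apply: uniq_perm; first exact: symdyck_paths_uniq.
  by rewrite map_inj_uniq ?half_words_uniq // => v w E; rewrite -(szE v) E szE.
move=> mu; rewrite mem_symdyck_paths path_sizeE; apply/andP/mapP => [[S /eqP Z]|[w]].
  exists (take (half_len mu) mu); last exact: sym_dyckE.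
  by rewrite mem_half_words Z eqxx -sym_dyck_unfold -sym_dyckE.
rewrite mem_half_words => /andP[Z U] ->.
by rewrite sym_dyck_unfold szE Z U.
Qed.

(** A 0 is matched within the half-word exactly when some prefix of what
    follows has more 1s than 0s.  If the partner lay beyond the half-word, such a
    prefix would be part of a prime Dyck path, in which no proper non-empty
    prefix has caught up. *)
Lemma partner_unfold w i : unmatched w = 0 -> i < size w -> nth true w i = false ->
  (partner (unfold_half w) i < size w) = (0 < unmatched (drop i.+1 w)).
Proof.
move=> U hi h0; set mu := unfold_half w.
have D : dyck mu by have := sym_dyck_unfold w; rewrite U eqxx => /andP[].
have sz : size mu = size w + size w by rewrite size_cat size_mirror.
have h0' : nth true mu i = false by rewrite nth_unfold.
have /andP[ip ps] : i < partner mu i < size mu by apply: partner_lt => //; lia.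
have prP : prime_dyck (factor mu i (partner mu i)).
  have hs : has (fun j => (i < j) && prime_dyck (factor mu i j)) (iota 0 (size mu)).
    by rewrite has_find size_iota.
  by have := nth_find 0 hs; rewrite nth_iota //= => /andP[].
have fE k : i + k < size w -> factor mu i (i + k) = false :: take k (drop i.+1 w).
  move=> hk; rewrite /factor take_unfold; last lia.
  rewrite (drop_nth true) ?size_take_min; last lia.
  by rewrite nth_take ?h0 ?take_drop; [congr (_ :: drop _ (take _ _)); lia | lia].
apply/idP/idP => [ltp|pos].
  rewrite ltnNge leqn0; apply/unmatched0P => /(_ (partner mu i - i)).
  case/and3P: prP => /andP[/eqP E _] _ _; move: E.
  have {1 2}-> : partner mu i = i + (partner mu i - i) by lia.
  by rewrite fE; [rewrite /zeros /ones /=; lia | lia].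
rewrite ltnNge; apply/negP => gep; move: pos; rewrite lt0n => /unmatched0P; apply=> k.
wlog hk : k / i + k < size w.
  move=> H; case: (ltnP (i + k) (size w)) => hk; first exact: H.
  have := H (size w - i.+1) ltac:(lia).
  by rewrite !take_oversize ?size_drop //; lia.
have [/andP[/eqP E /forallP F] _ /forallP G] := and3P prP.
have szf : size (factor mu i (partner mu i)) = (partner mu i).+1 - i.
  by rewrite /factor size_drop size_take_min; lia.
have T : take k.+1 (factor mu i (partner mu i)) = factor mu i (i + k).
  by rewrite /factor take_drop take_takel ?addSn 1?addnC //; lia.
have kb : k.+1 < (size (factor mu i (partner mu i))).+1 by lia.
have := F (Ordinal kb); have := G (Ordinal kb); rewrite /= T fE //.
by rewrite /zeros /ones /=; lia.
Qed.

Lemma count_zeros_drop w b :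
  count (fun i => (b < i) && (nth true w i == false)) (iota 0 (size w))
  = zeros (drop b.+1 w).
Proof.
have all0 v : count (fun i => nth true v i == false) (iota 0 (size v)) = zeros v.
  elim: v => //= x v IH; rewrite -[1]/(1 + 0) iotaDl count_map /zeros /= -[count_mem _ _]IH.
  by congr (_ + _); case: x.
elim: w b => [|x w IH] b //=; rewrite -[1]/(1 + 0) iotaDl count_map add0n.
by case: b => [|b]; [rewrite drop0 -all0 | rewrite -IH].
Qed.

(** * Inv as the weight of the half-word *)

Lemma weight_sum w :
  weight w = \sum_(i <- iota 0 (size w)) letter_weight (nth true w i) (drop i.+1 w).
Proof.
elim: w => [|x w IH]; first by rewrite big_nil.
by rewrite /= big_cons drop0 -[1]/(1 + 0) iotaDl big_map IH.
Qed.

(** Every 0 opens an arch or is a half-arch, so the two counts to the right of a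
    half-arch add up to the number of 0s there; the summand k of Inv1 is
    distributed as one unit per half-arch. *)
Lemma Inv1_unfold w : unmatched w = 0 ->
  Inv1 (unfold_half w) =
  \sum_(i <- iota 0 (size w) | ~~ nth true w i) letter_weight false (drop i.+1 w).
Proof.
move=> U; rewrite /Inv1.
set mu := unfold_half w.
have zE b : count (fun a => b < a.1) (arches mu) + count (fun b' => b < b') (half_arches mu)
    = zeros (drop b.+1 w).
  rewrite -count_zeros_drop /arches /half_arches half_len_unfold count_map !count_filter.
  rewrite -count_predUI [X in _ + X](_ : _ = 0); last first.
    by apply/eqP; rewrite -leqn0 leqNgt -has_count; apply/hasPn => i _ /=; lia.
  rewrite addn0; apply: eq_in_count => i; rewrite mem_iota add0n => /andP[_ hi] /=.
  by rewrite nth_unfold //; case: (nth true w i == false); lia.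
rewrite -sum1_size -!big_split /=.
under eq_bigr => b _ do rewrite -addnA zE.
rewrite /half_arches half_len_unfold big_filter big_seq_cond [RHS]big_seq_cond.
rewrite big_mkcond [RHS]big_mkcond /=; apply: eq_bigr => i _; rewrite mem_iota add0n /=.
case: (ltnP i (size w)) => //= hi; rewrite nth_unfold // /letter_weight.
case E: (nth true w i) => //=; rewrite leqNgt partner_unfold // -eqn0Ngt.
by case: ifP.
Qed.

Lemma Inv2_unfold w :
  Inv2 (unfold_half w) = \sum_(i <- iota 0 (size w) | nth true w i) zeros (drop i.+1 w).
Proof.
rewrite /Inv2 half_len_unfold -sum1dep_card.
rewrite (eq_bigl (fun p : 'I_(size w) * 'I_(size w) => nth true w p.1 &&
   ((p.1 < p.2) && (nth true w p.2 == false)))); last first.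
  by move=> [i j] /=; rewrite !nth_unfold // eqb_id andbCA.
rewrite -(pair_big_dep (fun i : 'I_(size w) => nth true w i)
   (fun i j : 'I_(size w) => (i < j) && (nth true w j == false)) (fun _ _ => 1)) /=.
rewrite -[X in iota 0 X]subn0 -/(index_iota 0 _) big_mkord; apply: eq_bigr => i _.
rewrite -count_zeros_drop -sum1_count.
by rewrite -[X in iota 0 X]subn0 -/(index_iota 0 _) big_mkord.
Qed.

Lemma Inv_unfold w : unmatched w = 0 -> Inv (unfold_half w) = weight w.
Proof.
move=> U; rewrite /Inv Inv1_unfold // Inv2_unfold weight_sum.
rewrite [RHS](bigID (nth true w)) /= addnC.
by congr (_ + _); apply: eq_bigr => i; [move=> -> | move=> /negbTE->].
Qed.

Local Open Scope ring_scope.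

(** * The q-ballot polynomials *)

(** The generating polynomial, by number of pairs (1, 0) in order, of the words
    with n letters 0 and n + e letters 1 all of whose suffixes have at least as
    many 1s as 0s; the recursion removes the first letter.  For e = 0 these
    are the Dyck paths of semilength n. *)
Fixpoint qballot (n : nat) : nat -> {poly int} :=
  if n is n'.+1 then
    fix qballot_n e :=
      if e is e'.+1 then 'X^n * qballot_n e' + qballot n' e'.+2 else qballot n' 1
  else fun=> 1.

Lemma qballotS0 n : qballot n.+1 0 = qballot n 1.
Proof. by []. Qed.

Lemma qballotSS n e :
  qballot n.+1 e.+1 = 'X^(n.+1) * qballot n.+1 e + qballot n e.+2.
Proof. by []. Qed.

Arguments qballot : simpl never.

(** The index p.+1 accounts for the letter 1 appended at the end of a half-word.
    A half-word starting with a half-arch corresponds to a word that starts with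
    1 followed by a Dyck path, hence the term with [qballot n.+1 0 = qballot n 1]
    in the recurrence at p = 0. *)
Lemma sum_weight_half_words n p :
  \sum_(w <- half_words n p) 'X^(weight w) = qballot n p.+1.
Proof.
elim: n p => [|n IHn].
  move=> p; rewrite big_seq1 (_ : weight _ = 0%N) //.
  by elim: p => //= p ->; rewrite addn0 /zeros count_nseq.
elim=> [|p IHp].
  rewrite half_wordsS0 big_map big_cat /= qballotSS qballotS0 addrC -!IHn mulr_sumr.
  congr (_ + _); apply: eq_big_seq => w; rewrite mem_half_words => /andP[/eqP Z /eqP U].
    by rewrite /letter_weight U Z exprD.
  by rewrite /letter_weight U.
rewrite half_wordsSS big_cat !big_map /= qballotSS -IHp -IHn mulr_sumr.
congr (_ + _); apply: eq_big_seq => w; rewrite mem_half_words => /andP[/eqP Z /eqP U].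
  by rewrite /letter_weight Z exprD.
by rewrite /letter_weight U.
Qed.

(** * The q-Catalan equation *)

(** The series H_n cut off after degree D. *)
Definition qballot_gf (D n : nat) : {poly {poly int}} :=
  \sum_(e < D.+1) (qballot n e)%:P * 'X^e.

(** The equation H_n = qballot n 0 + z (1 - q^(n+1) z) H_(n+1); the last term is
    the error of cutting off, and is divisible by z^(D+1). *)
Lemma qballot_gfS D n :
  qballot_gf D n = (qballot n 0)%:P + 'X * (1 - ('X^(n.+1))%:P * 'X) * qballot_gf D n.+1
    + 'X^(D.+1) * (('X^(n.+1) * qballot n.+1 D)%:P * 'X - (qballot n D.+1)%:P).
Proof.
elim: D => [|D IH]; rewrite /qballot_gf.
  rewrite !big_ord1 qballotS0 polyCM; ring.
rewrite big_ord_recr -/(qballot_gf D n) {}IH [in RHS]big_ord_recr -/(qballot_gf D n.+1) /=.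
rewrite qballotSS polyCM polyCD polyCM !exprS; ring.
Qed.

(** The start is (1 - z) H_0 = 1, where H_0 is the geometric series; the errors
    of the successive substitutions are collected in R. *)
Lemma qballot_gf_telescope D n : exists R : {poly {poly int}},
  1 = \sum_(i < n) (qballot i 0)%:P * 'X^i * \prod_(j < i.+1) (1 - ('X^j)%:P * 'X)
    + 'X^n * \prod_(j < n.+1) (1 - ('X^j)%:P * 'X) * qballot_gf D n + 'X^(D.+1) * R.
Proof.
elim: n => [|n [R E]].
  exists 1; rewrite big_ord0 big_ord1 /qballot_gf add0r !expr0 !mul1r.
  elim: D => [|D IH]; first by rewrite big_ord1 /=; ring.
  by rewrite big_ord_recr mulrDr [LHS]IH /= mul1r !exprS; ring.
set Q := \prod_(j < n.+1) _ in E.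
exists (R + 'X^n * Q * (('X^(n.+1) * qballot n.+1 D)%:P * 'X - (qballot n D.+1)%:P)).
rewrite [LHS]E qballot_gfS [\prod_(j < n.+2) _]big_ord_recr -/Q.
by rewrite [\sum_(i < n.+1) _]big_ord_recr -/Q /= !exprS; ring.
Qed.

Lemma is_qCatalan_qballot : is_qCatalan (qballot^~ 0%N).
Proof.
(* After multiplication by z the two remainders have orders at least N + 1 and
   d + 2, so for N >= d neither reaches degree d. *)
move=> d; exists d => N dN; have [R E] := qballot_gf_telescope d N.
rewrite big_add1 big_mkord /=.
under eq_bigr => i _ do rewrite exprS mulrCA -mulrA.
rewrite -mulr_sumr.
set Q := \prod_(j < N.+1) _ in E; set S := \sum_(i < N) _ in E *.
have -> : 'X * S = 'X - 'X^(N.+1) * (Q * qballot_gf d N) - 'X^(d.+2) * R.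
  have -> : S = 1 - 'X^N * Q * qballot_gf d N - 'X^(d.+1) * R by rewrite [X in X - _ - _]E; ring.
  by rewrite !exprS; ring.
by rewrite !coefB !coefXnM !ltnS dN leqnSn !subr0.
Qed.

Theorem proposition6p11 (C : nat -> {poly int}) (hC : is_qCatalan C)
    (n : nat) (hn : (1 <= n)%N) :
  \sum_(mu <- symdyck_paths n) 'X^(Inv mu) = C n.+1.
Proof.
rewrite (is_qCatalan_unique hC is_qCatalan_qballot) qballotS0 -sum_weight_half_words.
rewrite (perm_big _ (symdyck_paths_half_words n)) big_map.
apply: eq_big_seq => w; rewrite mem_half_words => /andP[_ /eqP U].
by rewrite Inv_unfold.
Qed.
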